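(* Let $f$ satisfy conditions (G1), (G2), (G3) and (K) of the context. Then $U(r,\infty)r^{m(l_s)}$ is non-decreasing for $r>0$, and $U(r,\alpha)<U(r,\infty)$ for any $r>0$ and any $\alpha>0$.
   Context: Let $n>2$ be an integer, $2^*=\frac{2n}{n-2}$, and let $f=f(u,r)$ ($u\ge0$, $r>0$) satisfy $f(0,r)=0$. For $l>2$ put $m(l)=\frac{2}{l-2}$, $A(l)=n-2-2m(l)$, $B(l)=m(l)[n-2-m(l)]$ and $$g(y,s;l)=f\big(y e^{-m(l)s},e^s\big)e^{(m(l)+2)s},\qquad y\ge 0,\ s\in\mathbb{R}.$$ (G0) (for an $s$-independent function $g(\cdot)$): $g(0)=0=g'(0)$, $g'(y)$ is positive and strictly increasing for $y>0$, and $g'(y)\to+\infty$ as $y\to+\infty$. For such $g$ and $l$ with $B(l)>0$ let $P_1=P_1(l)$ be the unique positive solution of $g(P_1)=B(l)P_1$; $\sigma_*<\sigma^*$ denote the real solutions $l$ of $A(l)^2-4[g'(P_1)-B(l)]=0$. (G1) There is $l_u\ge\sigma^*$ such that for any $y>0$ the function $g(y,s;l_u)$ converges to an $s$-independent $C^1$ function $g(y,-\infty;l_u)\not\equiv0$ as $s\to-\infty$, uniformly on compact intervals; $g(\cdot,s;l_u)$ satisfies (G0) for any $s\in\mathbb{R}$; and there is $\varpi>0$ such that $\lim_{s\to-\infty}e^{-\varpi s}\partial_sg(y,s;l_u)=0$. (Here $\sigma^*$ is the one of $g(\cdot,-\infty;l_u)$.) (G2) There is $l_s\ge\sigma^*$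 such that for any $y>0$ the function $g(y,s;l_s)$ converges to an $s$-independent $C^1$ function $g(y,+\infty;l_s)\not\equiv0$ as $s\to+\infty$, uniformly on compact intervals; $g(\cdot,s;l_s)$ satisfies (G0) for any $s\in\mathbb{R}$; and there is $\varpi>0$ such that $\lim_{s\to+\infty}e^{\varpi s}\partial_sg(y,s;l_s)=0$. (Here $\sigma^*$ is the one of $g(\cdot,+\infty;l_s)$.) (G3) (G2) holds and $g(y,s;l_s)$ and $\partial_yg(y,s;l_s)$ are decreasing in $s$ for any $y>0$. (K) Either $f(u,r)=k(r)r^{\delta}u^{q-1}$ with $\delta>-2$, or $f(u,r)=k_1(r)r^{\delta_1}|u|^{q_1-1}+k_2(r)r^{\delta_2}|u|^{q_2-1}$ with $q_1<q_2$, $k_i\in C^1$ and $\frac{2+\delta_2}{q_2-2}(q_2-q_1)+\delta_1-\delta_2<0$. $U(r,\alpha)$, $\alpha>0$, is the unique solution of $U''+\frac{n-1}{r}U'+f(U,r)=0$ with $U(0,\alpha)=\alpha$ (under these assumptions it is positive for all $r>0$). $U(r,\infty)$ denotes the unique singular solution of the same equation, i.e. the unique positive solution on $(0,\infty)$ with $\lim_{r\to0}U(r,\infty)=+\infty$; under these assumptions such a solution exists and is unique.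
   Formalization: In the two-power case of (K) the weights are also assumed normalised: for large r, k_1 is bounded above and k_2 is bounded below by a positive constant. Otherwise powers of r can be moved into k_1, the inequality between the exponents is void and the claim fails. *)

(* Defs.v *)
From Stdlib Require Export Reals.
From Coquelicot Require Export Coquelicot.

Open Scope R_scope.

(** Functions of [u >= 0] or [r > 0] are total functions on [R] of which only
    the values on the stated domain are ever used. *)

Definition mexp (l : R) : R := 2 / (l - 2).

Definition Acoef (n : nat) (l : R) : R := INR n - 2 - 2 * mexp l.

Definition Bcoef (n : nat) (l : R) : R := mexp l * (INR n - 2 - mexp l).

Definition gfun (f : R -> R -> R) (l y s : R) : R :=
  f (y * exp (- mexp l * s)) (exp s) * exp ((mexp l + 2) * s).

Definition C1_pos (h : R -> R) : Prop :=
  forall x, 0 < x -> ex_derive h x /\ continuous (Derive h) x.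

(** The derivative at the end point [0] of the domain is one-sided. *)
Definition G0 (g : R -> R) : Prop :=
  g 0 = 0 /\
  filterlim (fun y => (g y - g 0) / y) (at_right 0) (locally 0) /\
  (forall y, 0 < y -> ex_derive g y /\ 0 < Derive g y) /\
  (forall x y, 0 < x -> x < y -> Derive g x < Derive g y) /\
  is_lim (Derive g) p_infty p_infty.

Definition is_P1 (n : nat) (g : R -> R) (l P : R) : Prop :=
  unique (fun P => 0 < P /\ g P = Bcoef n l * P) P.

(** [l] is a solution of [A(l)^2 - 4 [g'(P1(l)) - B(l)] = 0]; [P1(l)] only makes
    sense for [l > 2] and [B(l) > 0]. *)
Definition sigma_equation (n : nat) (g : R -> R) (l : R) : Prop :=
  2 < l /\ 0 < Bcoef n l /\
  exists P, is_P1 n g l P /\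
    Acoef n l ^ 2 - 4 * (Derive g P - Bcoef n l) = 0.

Definition is_sigma_upper (n : nat) (g : R -> R) (sigma : R) : Prop :=
  exists sigma_low, sigma_low < sigma /\
    forall l, sigma_equation n g l <-> l = sigma_low \/ l = sigma.

Definition cvg_compact_pos (g : R -> R -> R) (e : Rbar) (h : R -> R) : Prop :=
  forall a b, 0 < a -> a <= b -> forall eps, 0 < eps ->
    Rbar_locally e (fun s => forall y, a <= y <= b -> Rabs (g y s - h y) < eps).

Definition G1 (n : nat) (f : R -> R -> R) (lu : R) : Prop :=
  (exists ginf : R -> R,
     C1_pos ginf /\
     (exists y, 0 < y /\ ginf y <> 0) /\
     cvg_compact_pos (gfun f lu) m_infty ginf /\
     (exists sigma, is_sigma_upper n ginf sigma /\ sigma <= lu)) /\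
  (forall s, G0 (fun y => gfun f lu y s)) /\
  (forall y s, 0 < y -> ex_derive (gfun f lu y) s) /\
  (exists w, 0 < w /\ forall y, 0 < y ->
     is_lim (fun s => exp (- w * s) * Derive (gfun f lu y) s) m_infty 0).

Definition G2 (n : nat) (f : R -> R -> R) (ls : R) : Prop :=
  (exists ginf : R -> R,
     C1_pos ginf /\
     (exists y, 0 < y /\ ginf y <> 0) /\
     cvg_compact_pos (gfun f ls) p_infty ginf /\
     (exists sigma, is_sigma_upper n ginf sigma /\ sigma <= ls)) /\
  (forall s, G0 (fun y => gfun f ls y s)) /\
  (forall y s, 0 < y -> ex_derive (gfun f ls y) s) /\
  (exists w, 0 < w /\ forall y, 0 < y ->
     is_lim (fun s => exp (w * s) * Derive (gfun f ls y) s) p_infty 0).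

Definition G3 (n : nat) (f : R -> R -> R) (ls : R) : Prop :=
  G2 n f ls /\
  forall y s1 s2, 0 < y -> s1 <= s2 ->
    gfun f ls y s2 <= gfun f ls y s1 /\
    Derive (fun z => gfun f ls z s2) y <= Derive (fun z => gfun f ls z s1) y.

(** The formulas are required for [u > 0] only: at [u = 0] they say
    [f 0 r = 0], which is a hypothesis of its own, whereas [Rpower 0 a = 1]. *)
Definition K_one (f : R -> R -> R) : Prop :=
  exists (k : R -> R) (delta q : R),
    -2 < delta /\
    forall u r, 0 < u -> 0 < r ->
      f u r = k r * Rpower r delta * Rpower u (q - 1).

(** The exponents [delta1], [delta2] describe the coefficients only once the
    weights [k1], [k2] are normalised: any power of [r] can otherwise be moved
    from [Rpower r delta1] into [k1], which makes the inequality between the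
    exponents void. The last clause is that normalisation, at infinity and in
    the direction in which the inequality is oriented; it holds in particular
    for weights lying between two positive constants. *)
Definition K_two (f : R -> R -> R) : Prop :=
  exists (k1 k2 : R -> R) (delta1 delta2 q1 q2 : R),
    q1 < q2 /\ C1_pos k1 /\ C1_pos k2 /\
    (2 + delta2) / (q2 - 2) * (q2 - q1) + delta1 - delta2 < 0 /\
    (forall u r, 0 < u -> 0 < r ->
      f u r = k1 r * Rpower r delta1 * Rpower (Rabs u) (q1 - 1)
            + k2 r * Rpower r delta2 * Rpower (Rabs u) (q2 - 1)) /\
    (exists c C, 0 < c /\
       Rbar_locally p_infty (fun r => k1 r <= C /\ c <= k2 r)).

Definition K (f : R -> R -> R) : Prop := K_one f \/ K_two f.

(** [0 <= U r] because [f] is only given for [u >= 0]. *)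
Definition is_solution (n : nat) (f : R -> R -> R) (U : R -> R) : Prop :=
  forall r, 0 < r ->
    0 <= U r /\ ex_derive U r /\ ex_derive (Derive U) r /\
    Derive (Derive U) r + (INR n - 1) / r * Derive U r + f (U r) r = 0.

(** [U = U(., alpha)]. The initial value is taken continuously: since [f] may
    be singular at [r = 0], nothing is required of [U'] there. *)
Definition is_regular_solution
    (n : nat) (f : R -> R -> R) (alpha : R) (U : R -> R) : Prop :=
  is_solution n f U /\
  U 0 = alpha /\ filterlim U (at_right 0) (locally alpha).

Definition is_singular_solution
    (n : nat) (f : R -> R -> R) (U : R -> R) : Prop :=
  is_solution n f U /\
  (forall r, 0 < r -> 0 < U r) /\
  filterlim U (at_right 0) (Rbar_locally p_infty).

(* Main.v *)
Require Import Defs.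
From Stdlib Require Import Lra.

(** In the variables [s = ln r] and [y s = U (exp s) * exp (m s)], [m = mexp ls],
    the equation becomes the damped oscillator
    [y'' + A y' = F], [F s = B * y s - g (y s) s], where [g] decreases in time
    and [A > 0]. The theorem says that the singular [y] is nondecreasing and
    that it stays above every regular one; both follow from [F >= 0] along the
    singular solution.

    Linear stability. By (K), [g y s = a s * y^p1 + b s * y^p2] with [p1 < p2]
    and [a s >= 0], and [a s] tends to [0] at infinity, so that the limit
    profile is a multiple of [y^p2]. For a pure power the equation that defines
    [sigma^*] reads [4 p2 B(l) = (n - 2)^2]; as [B] is symmetric in [m] about
    [(n - 2) / 2], the condition [ls >= sigma^*] gives [A > 0] and
    [p2 B <= B + A^2 / 4]. Since [y g_y <= p2 g], the bound [g_y <= B + A^2 / 4]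
    holds at every time and every [y] with [g y s <= B y]
    ([gfun_damped]): the linearisation does not oscillate wherever [F >= 0].

    The sign of [F]. All the arguments run backwards in time, and damping is
    then growth. If [0 < z] and [F < (A / 2) z] at some time, with [z = y'],
    these two inequalities persist at earlier times and [z] stays bounded away
    from [0], which drives [y] below [0]; hence [(A / 2) z <= F] wherever
    [z > 0] ([slope_le_force]). If [F < 0] at some time then
    [z <= 0], so [y] was larger earlier, and convexity of [g] together with its
    monotonicity in time makes [F] negative at all earlier times. Then [y] tends
    to infinity backwards, where the superlinear force would make it oscillate:
    the Riccati variable [z / y] becomes positive, against [z <= 0]
    ([force_nonneg]).

    Conclusion. From [(exp (A s) z)' = exp (A s) F >= 0] a negative [z] would
    again make [y] unbounded at minus infinity, where [F >= 0] bounds it; thus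
    [z >= 0] ([slope_nonneg]). For a regular solution [y2], the function
    [exp (A s / 2) (y - y2)] is convex as long as it is positive, by the same
    bound on [g_y], and it is bounded at minus infinity, so it cannot come down
    to [0] ([strict_comparison]). *)

(** * Functions of one real variable *)

Lemma nondecreasing_of_derive (h : R -> R) (a b : R) :
  a <= b ->
  (forall x, a <= x <= b -> exists d, is_derive h x d /\ 0 <= d) ->
  h a <= h b.
Proof.
  intros [Hab | ->] Hd; [| lra].
  assert (HD : forall x, a <= x <= b ->
            is_derive h x (Derive h x) /\ 0 <= Derive h x).
  { intros x Hx. destruct (Hd x Hx) as [d [H1 H2]].
    rewrite (is_derive_unique _ _ _ H1). auto. }
  destruct (MVT_cor2 h (Derive h) a b Hab) as [c [Hc Hc']].
  { intros c Hc. apply is_derive_Reals. apply HD, Hc. }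
  assert (0 <= Derive h c) by (apply HD; lra).
  nra.
Qed.

Lemma nonincreasing_of_derive (h : R -> R) (a b : R) :
  a <= b ->
  (forall x, a <= x <= b -> exists d, is_derive h x d /\ d <= 0) ->
  h b <= h a.
Proof.
  intros Hab Hd.
  assert (- h a <= - h b); [| lra].
  apply (nondecreasing_of_derive (fun x => - h x)); [exact Hab |].
  intros x Hx. destruct (Hd x Hx) as [d [H1 H2]].
  exists (- d). split; [| lra].
  exact (is_derive_opp h x d H1).
Qed.

Lemma derive_nonpos_of_nonincreasing (h : R -> R) (s d : R) :
  (forall s1 s2, s1 <= s2 -> h s2 <= h s1) -> is_derive h s d -> d <= 0.
Proof.
  intros Hm Hd. apply Rnot_lt_le. intros Hpos.
  apply is_derive_Reals in Hd.
  destruct (Hd (d / 2)) as [delta Hdelta]; [lra |].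
  pose proof (cond_pos delta) as Hp.
  specialize (Hdelta (delta / 2)).
  rewrite (Rabs_pos_eq (delta / 2)) in Hdelta by lra.
  specialize (Hdelta ltac:(lra) ltac:(lra)).
  apply Rabs_def2 in Hdelta as [_ Hlow].
  pose proof (Hm s (s + delta / 2) ltac:(lra)) as Hle.
  assert ((h (s + delta / 2) - h s) / (delta / 2) <= 0).
  { unfold Rdiv at 1. assert (0 < / (delta / 2)) by (apply Rinv_0_lt_compat; lra).
    nra. }
  lra.
Qed.

Lemma continuous_eps (h : R -> R) (x eps : R) :
  continuous h x -> 0 < eps ->
  exists d, 0 < d /\ forall t, Rabs (t - x) < d -> Rabs (h t - h x) < eps.
Proof.
  intros Hc He.
  destruct (proj1 (filterlim_locally h (h x)) Hc (mkposreal eps He)) as [d Hd].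
  exists d. split; [apply cond_pos |]. intros t Ht. exact (Hd t Ht).
Qed.

(** Continuous induction, backwards from [b]: a negative continuous function
    that is not negative all the way back to [a] has a last zero. *)
Lemma last_zero (h : R -> R) (a b : R) :
  (forall x, continuous h x) -> a <= b -> 0 <= h a -> h b < 0 ->
  exists t, a <= t < b /\ h t = 0 /\ forall x, t < x <= b -> h x < 0.
Proof.
  intros Hc Hab Ha Hb.
  destruct (completeness (fun x => a <= x <= b /\ 0 <= h x)) as [t [Hub Hlub]].
  { exists b. intros x [Hx _]. lra. }
  { exists a. split; [lra | exact Ha]. }
  assert (Hat : a <= t) by (apply Hub; split; [lra | exact Ha]).
  assert (Htb : t <= b) by (apply Hlub; intros x [Hx _]; lra).
  assert (Hneg : forall x, t < x <= b -> h x < 0).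
  { intros x Hx. apply Rnot_le_lt. intros Hx0.
    assert (x <= t) by (apply Hub; split; [lra | exact Hx0]). lra. }
  assert (Ht0 : 0 <= h t).
  { apply Rnot_lt_le. intros Hlt.
    destruct (continuous_eps h t (- h t) (Hc t)) as [d [Hd Hnear]]; [lra |].
    assert (t <= t - d); [| lra].
    apply Hlub. intros x [Hx Hx0]. apply Rnot_lt_le. intros Hxd.
    assert (x <= t) by (apply Hub; split; assumption).
    assert (Hn : Rabs (h x - h t) < - h t).
    { apply Hnear. apply Rabs_def1; lra. }
    apply Rabs_def2 in Hn. lra. }
  assert (Htb' : t < b).
  { destruct Htb as [Htb | ->]; [exact Htb | lra]. }
  exists t. split; [lra | split; [| exact Hneg]].
  apply Rle_antisym; [| exact Ht0].
  apply Rnot_lt_le. intros Hgt.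
  destruct (continuous_eps h t (h t) (Hc t) Hgt) as [d [Hd Hnear]].
  set (x := Rmin b (t + d / 2)).
  assert (t < x <= b /\ x <= t + d / 2) as [Hx Hx'].
  { unfold x. pose proof (Rmin_l b (t + d / 2)). pose proof (Rmin_r b (t + d / 2)).
    split; [split; [apply Rmin_glb_lt; lra | lra] | lra]. }
  assert (Hn : Rabs (h x - h t) < h t) by (apply Hnear; apply Rabs_def1; lra).
  apply Rabs_def2 in Hn. pose proof (Hneg x Hx). lra.
Qed.

(** * Superlinear convex functions *)

Lemma G0_small (g : R -> R) (eps : R) :
  G0 g -> 0 < eps ->
  exists d, 0 < d /\ forall y, 0 < y < d -> Rabs (g y) <= eps * y.
Proof.
  intros (H0 & Hl & _) He.
  destruct (proj1 (filterlim_locally _ 0) Hl (mkposreal eps He)) as [d Hd].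
  exists d. split; [apply cond_pos |]. intros y [Hy Hyd].
  assert (Hb : Rabs ((g y - g 0) / y - 0) < eps).
  { apply Hd; [| exact Hy]. unfold ball; simpl; unfold AbsRing_ball, abs, minus, plus, opp; simpl.
    apply Rabs_def1; lra. }
  rewrite H0 in Hb.
  replace ((g y - 0) / y - 0) with (g y / y) in Hb by (field; lra).
  unfold Rdiv in Hb. rewrite Rabs_mult in Hb.
  rewrite (Rabs_pos_eq (/ y)) in Hb by (left; apply Rinv_0_lt_compat; lra).
  apply (Rmult_le_reg_r (/ y)); [apply Rinv_0_lt_compat; lra |].
  rewrite Rmult_assoc, Rinv_r by lra. lra.
Qed.

Lemma G0_MVT (g : R -> R) (x y : R) :
  G0 g -> 0 < x -> x < y ->
  exists c, x < c < y /\ g y - g x = Derive g c * (y - x).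
Proof.
  intros (_ & _ & Hd & _) Hx Hxy.
  destruct (MVT_cor2 g (Derive g) x y Hxy) as [c [Hc Hc']].
  { intros c Hc. apply is_derive_Reals, Derive_correct, Hd. lra. }
  exists c. auto.
Qed.

Lemma G0_nonneg (g : R -> R) (y : R) : G0 g -> 0 < y -> 0 <= g y.
Proof.
  intros HG Hy. apply Rnot_lt_le. intros Hneg.
  destruct (G0_small g 1 HG Rlt_0_1) as [d [Hd Hs]].
  set (x := Rmin (d / 2) (Rmin (y / 2) (- g y / 2))).
  assert (0 < x < d /\ x < y /\ x < - g y) as (Hx & Hxy & Hxg).
  { unfold x. pose proof (Rmin_l (d / 2) (Rmin (y / 2) (- g y / 2))).
    pose proof (Rmin_r (d / 2) (Rmin (y / 2) (- g y / 2))).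
    pose proof (Rmin_l (y / 2) (- g y / 2)).
    pose proof (Rmin_r (y / 2) (- g y / 2)).
    repeat split; try lra. repeat apply Rmin_glb_lt; lra. }
  pose proof (Hs x Hx) as Habs. apply Rabs_le_between in Habs.
  destruct (G0_MVT g x y HG ltac:(lra) Hxy) as [c [Hc He]].
  assert (0 < Derive g c) by (apply HG; lra). nra.
Qed.

Lemma G0_tangent_below (g : R -> R) (x y : R) :
  G0 g -> 0 < x -> x <= y -> Derive g x * (y - x) <= g y - g x.
Proof.
  intros HG Hx [Hxy | ->]; [| lra].
  destruct (G0_MVT g x y HG Hx Hxy) as [c [Hc ->]].
  assert (Derive g x < Derive g c) by (apply HG; lra). nra.
Qed.

Lemma G0_tangent_above (g : R -> R) (x y : R) :
  G0 g -> 0 <= x -> 0 < y -> x <= y -> g y - g x <= Derive g y * (y - x).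
Proof.
  intros HG Hx0 Hy Hxy.
  assert (Hpos : forall x, 0 < x -> x <= y -> g y - g x <= Derive g y * (y - x)).
  { clear x Hx0 Hxy. intros x Hx [Hxy | ->]; [| lra].
    destruct (G0_MVT g x y HG Hx Hxy) as [c [Hc ->]].
    assert (Derive g c < Derive g y) by (apply HG; lra). nra. }
  destruct Hx0 as [Hx0 | <-]; [auto |].
  assert (g 0 = 0) as -> by apply HG.
  apply Rnot_lt_le. intros Hlt.
  set (e := g y - Derive g y * y).
  assert (He : 0 < e) by (unfold e; lra).
  destruct (G0_small g 1 HG Rlt_0_1) as [d [Hd Hs]].
  set (x := Rmin (d / 2) (Rmin y (e / 2))).
  assert (0 < x < d /\ x <= y /\ x < e) as (Hx & Hxy' & Hxe).
  { unfold x. pose proof (Rmin_l (d / 2) (Rmin y (e / 2))).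
    pose proof (Rmin_r (d / 2) (Rmin y (e / 2))).
    pose proof (Rmin_l y (e / 2)).
    pose proof (Rmin_r y (e / 2)).
    repeat split; try lra. repeat apply Rmin_glb_lt; lra. }
  pose proof (Hs x Hx) as Habs. apply Rabs_le_between in Habs.
  pose proof (Hpos x ltac:(lra) Hxy').
  assert (0 < Derive g y) by (apply HG; lra).
  unfold e in *. nra.
Qed.

(** Since [g 0 = 0], convexity makes [g y / y] nondecreasing. *)
Lemma G0_star_shaped (g : R -> R) (x y : R) :
  G0 g -> 0 < x -> x <= y -> g x * y <= g y * x.
Proof.
  intros HG Hx Hxy.
  pose proof (G0_tangent_below g x y HG Hx Hxy).
  pose proof (G0_tangent_above g 0 x HG ltac:(lra) Hx ltac:(lra)) as H1.
  assert (g 0 = 0) as H0 by apply HG. rewrite H0 in H1.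
  assert (g x * (y - x) <= (Derive g x * x) * (y - x)) by
    (apply Rmult_le_compat_r; lra).
  nra.
Qed.

Lemma G0_superlinear (g : R -> R) (C : R) :
  G0 g -> exists Y, 0 < Y /\ forall y, Y <= y -> C * y <= g y.
Proof.
  intros HG.
  assert (Hl : is_lim (Derive g) p_infty p_infty) by apply HG.
  apply is_lim_spec in Hl. destruct (Hl (2 * Rabs C)) as [M HM].
  set (x := Rmax 1 (M + 1)).
  assert (1 <= x /\ M < x) as [Hx HMx].
  { unfold x. pose proof (Rmax_l 1 (M + 1)). pose proof (Rmax_r 1 (M + 1)). lra. }
  exists (2 * x). split; [lra |]. intros y Hy.
  pose proof (G0_tangent_below g x y HG ltac:(lra) ltac:(lra)).
  pose proof (G0_nonneg g x HG ltac:(lra)).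
  pose proof (HM x HMx). pose proof (Rle_abs C). pose proof (Rabs_pos C).
  assert (2 * Rabs C * (y - x) <= Derive g x * (y - x)) by
    (apply Rmult_le_compat_r; lra).
  nra.
Qed.

(** * The damped equation [y'' + A y' - B y + g(y, s) = 0] *)

(** What the dynamical arguments need from [g]. The field [damping_dominates]
    says that the linearised equation does not oscillate where the force
    [B y - g] is nonnegative: the discriminant [A^2 + 4 B - 4 g_y] of its
    characteristic polynomial is nonnegative there. In [derive_along], [d]
    stands for the partial derivative of [g] in time. *)
Record damped_nonlinearity (A B : R) (g : R -> R -> R) : Prop := {
  damping_pos : 0 < A;
  profile_G0 : forall s, G0 (fun x => g x s);
  decreasing_in_time :
    forall y s1 s2, 0 < y -> s1 <= s2 -> g y s2 <= g y s1;
  derive_along : forall (y : R -> R) s y', 0 < y s -> is_derive y s y' ->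
    exists d, d <= 0 /\
      is_derive (fun t => g (y t) t) s (Derive (fun x => g x s) (y s) * y' + d);
  damping_dominates : forall y s, 0 < y -> g y s <= B * y ->
    Derive (fun x => g x s) y <= B + A ^ 2 / 4 }.

Definition force (B : R) (g : R -> R -> R) (y : R -> R) (s : R) : R :=
  B * y s - g (y s) s.

(** The second-order equation as a first-order system, with [z = y']. *)
Definition damped_solution (A B : R) (g : R -> R -> R) (y z : R -> R) : Prop :=
  forall s, is_derive y s (z s) /\ is_derive z s (force B g y s - A * z s).

Lemma is_derive_value (h : R -> R) (s d d' : R) :
  is_derive h s d -> d = d' -> is_derive h s d'.
Proof. now intros H <-. Qed.

Lemma is_derive_exp_mul (h : R -> R) (c s d : R) :
  is_derive h s d ->
  is_derive (fun t => exp (c * t) * h t) s (exp (c * s) * (d + c * h s)).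
Proof.
  intros Hd. assert (He : ex_derive h s) by (exists d; exact Hd).
  auto_derive; [exact He |].
  change (fun x => h x) with h. rewrite (is_derive_unique _ _ _ Hd). ring.
Qed.


Lemma force_derive (A B : R) (g : R -> R -> R) (y z : R -> R) (s : R) :
  damped_nonlinearity A B g -> damped_solution A B g y z -> 0 < y s ->
  exists d, d <= 0 /\
    is_derive (force B g y) s
      ((B - Derive (fun x => g x s) (y s)) * z s - d).
Proof.
  intros Hg Hs Hy. destruct (Hs s) as [Hy' _].
  destruct (derive_along _ _ _ Hg y s (z s) Hy Hy') as [d [Hd Hg']].
  exists d. split; [exact Hd |]. unfold force.
  eapply is_derive_value.
  - apply (is_derive_minus (fun t => B * y t) (fun t => g (y t) t)).
    + apply is_derive_scal, Hy'.
    + exact Hg'.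
  - unfold minus, plus, opp; simpl. ring.
Qed.

Lemma force_continuous (A B : R) (g : R -> R -> R) (y z : R -> R) (s : R) :
  damped_nonlinearity A B g -> damped_solution A B g y z -> 0 < y s ->
  continuous (force B g y) s.
Proof.
  intros Hg Hs Hy. destruct (force_derive A B g y z s Hg Hs Hy) as [d [_ H]].
  apply (ex_derive_continuous (V := R_NormedModule)). eexists; exact H.
Qed.

Lemma backward_le_of_slope_ge (y z : R -> R) (s0 c : R) :
  (forall s, is_derive y s (z s)) ->
  (forall s, s <= s0 -> c <= z s) ->
  forall s, s <= s0 -> y s <= y s0 - c * (s0 - s).
Proof.
  intros Hd Hz s Hs.
  assert (y s - c * s <= y s0 - c * s0); [| lra].
  apply (nondecreasing_of_derive (fun t => y t - c * t)); [exact Hs |].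
  intros x Hx. exists (z x - c). split; [| specialize (Hz x); lra].
  pose proof (Hd x) as Hdx. assert (ex_derive y x) by (eexists; exact Hdx).
  auto_derive; [assumption |]. change (fun x => y x) with y.
  rewrite (is_derive_unique _ _ _ Hdx). ring.
Qed.

Lemma backward_ge_of_slope_le (y z : R -> R) (s0 c : R) :
  (forall s, is_derive y s (z s)) ->
  (forall s, s <= s0 -> z s <= - c) ->
  forall s, s <= s0 -> y s0 + c * (s0 - s) <= y s.
Proof.
  intros Hd Hz s Hs.
  pose proof (backward_le_of_slope_ge (fun t => - y t) (fun t => - z t) s0 c) as H.
  assert (- y s <= - y s0 - c * (s0 - s)); [| lra].
  apply H; [| | exact Hs].
  - intros t. exact (is_derive_opp y t _ (Hd t)).
  - intros t Ht. specialize (Hz t Ht). lra.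
Qed.

(** Let [Q = F - (A / 2) z]. Then [(exp (A s / 2) z)' = exp (A s / 2) Q], and by
    the discriminant condition [exp (A s / 2) Q] is nondecreasing as long as
    [F] and [z] are positive. If [z > 0 > Q] at some time, these two facts carry
    both signs to all earlier times, with [z] bounded away from [0]; so [y]
    would become negative. *)
Lemma slope_le_force (A B : R) (g : R -> R -> R) (y z : R -> R) :
  damped_nonlinearity A B g -> damped_solution A B g y z ->
  (forall s, 0 < y s) ->
  forall s, 0 < z s -> A / 2 * z s <= force B g y s.
Proof.
  intros Hg Hsol Hpos s0 Hz0. apply Rnot_lt_le. intros HQ0.
  pose proof (damping_pos _ _ _ Hg) as HA.
  set (F := force B g y) in *.
  set (Q := fun s => F s - A / 2 * z s).
  assert (HF : forall s, continuous F s)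
    by (intros s; eapply force_continuous; eauto).
  assert (Hzc : forall s, continuous z s).
  { intros s. apply (ex_derive_continuous (V := R_NormedModule)).
    eexists; apply Hsol. }
  assert (HQc : forall s, continuous Q s).
  { intros s. unfold Q.
    apply (continuous_minus F (fun s => A / 2 * z s) s (HF s)).
    apply (continuous_scal_r (A / 2) z s (Hzc s)). }
  (* while [Q <= 0], the weighted slope decreases *)
  assert (Hslope : forall s, s <= s0 ->
            (forall x, s <= x <= s0 -> Q x <= 0) -> z s0 <= z s).
  { intros s Hs HQ.
    assert (Hm : exp (A / 2 * s0) * z s0 <= exp (A / 2 * s) * z s).
    { apply (nonincreasing_of_derive (fun t => exp (A / 2 * t) * z t) s s0 Hs).
      intros x Hx. eexists. split; [apply is_derive_exp_mul, Hsol |].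
      specialize (HQ x Hx). unfold Q, F in HQ.
      pose proof (exp_pos (A / 2 * x)). nra. }
    assert (exp (A / 2 * s) <= exp (A / 2 * s0)).
    { destruct Hs as [Hs | ->]; [| lra]. left. apply exp_increasing. nra. }
    pose proof (exp_pos (A / 2 * s)).
    pose proof (exp_pos (A / 2 * s0)).
    nra. }
  assert (HQneg : forall s, s <= s0 -> Q s < 0).
  { intros s1 Hs1. apply Rnot_le_lt. intros HQ1.
    destruct (last_zero Q s1 s0 HQc Hs1 HQ1) as [t [Ht [HQt Hlater]]].
    { unfold Q. lra. }
    assert (Hzt : z s0 <= z t).
    { apply Hslope; [lra |]. intros x [[Hx | <-] Hx']; [| lra].
      left. apply Hlater. lra. }
    (* a zero of [Q] with [z > 0] lies in the region [F > 0], where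
       [exp (A s / 2) Q] is nondecreasing, yet [Q] is negative just after [t] *)
    assert (HFt : 0 < F t) by (unfold Q in HQt; nra).
    destruct (continuous_eps F t (F t) (HF t) HFt) as [d1 [Hd1 HF1]].
    destruct (continuous_eps z t (z t) (Hzc t) ltac:(lra)) as [d2 [Hd2 Hz2]].
    set (e := Rmin (Rmin (d1 / 2) (d2 / 2)) (s0 - t)).
    assert (0 < e /\ e < d1 /\ e < d2 /\ e <= s0 - t) as (He & He1 & He2 & He3).
    { unfold e. pose proof (Rmin_l (Rmin (d1 / 2) (d2 / 2)) (s0 - t)).
      pose proof (Rmin_r (Rmin (d1 / 2) (d2 / 2)) (s0 - t)).
      pose proof (Rmin_l (d1 / 2) (d2 / 2)). pose proof (Rmin_r (d1 / 2) (d2 / 2)).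
      repeat split; try lra. repeat apply Rmin_glb_lt; lra. }
    assert (Hm : exp (A / 2 * t) * Q t <= exp (A / 2 * (t + e)) * Q (t + e)).
    { apply (nondecreasing_of_derive (fun x => exp (A / 2 * x) * Q x)); [lra |].
      intros x Hx.
      assert (HFx : 0 < F x).
      { assert (Hn : Rabs (F x - F t) < F t) by (apply HF1, Rabs_def1; lra).
        apply Rabs_def2 in Hn. lra. }
      assert (Hzx : 0 < z x).
      { assert (Hn : Rabs (z x - z t) < z t) by (apply Hz2, Rabs_def1; lra).
        apply Rabs_def2 in Hn. lra. }
      destruct (force_derive A B g y z x Hg Hsol (Hpos x)) as [d [Hd HF']].
      eexists. split.
      { apply is_derive_exp_mul.
        apply (is_derive_minus F (fun s => A / 2 * z s)); [exact HF' |].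
        apply is_derive_scal, Hsol. }
      pose proof (damping_dominates _ _ _ Hg (y x) x (Hpos x)) as Hdom.
      unfold F, force in HFx. specialize (Hdom ltac:(lra)).
      apply Rmult_le_pos; [left; apply exp_pos |].
      fold F. unfold Q, minus, plus, opp; simpl.
      assert (0 <= (B + A ^ 2 / 4 - Derive (fun x0 => g x0 x) (y x)) * z x)
        by (apply Rmult_le_pos; lra).
      unfold F, force in *. nra. }
    rewrite HQt in Hm. pose proof (Hlater (t + e) ltac:(lra)).
    pose proof (exp_pos (A / 2 * (t + e))). nra. }
  assert (Hzlow : forall s, s <= s0 -> z s0 <= z s).
  { intros s Hs. apply Hslope; [exact Hs |]. intros x Hx.
    left. apply HQneg. lra. }
  (* the line of slope [z s0] through [y s0] vanishes at [T] *)
  set (T := s0 - y s0 / z s0).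
  assert (Hq : z s0 * (s0 - T) = y s0) by (unfold T; field; lra).
  pose proof (Hpos s0).
  assert (HT : T <= s0) by nra.
  pose proof (backward_le_of_slope_ge y z s0 (z s0) (fun s => proj1 (Hsol s))
                Hzlow T HT) as Hlow.
  pose proof (Hpos T). lra.
Qed.

(** Equivalently, [y] never exceeds the positive zero of [B y - g y s]. The
    contradiction comes from minus infinity: a solution that lies above this
    zero once is unbounded and nonincreasing there, while the superlinear force
    makes large solutions oscillate. *)
Lemma force_nonneg (A B : R) (g : R -> R -> R) (y z : R -> R) :
  damped_nonlinearity A B g -> damped_solution A B g y z ->
  (forall s, 0 < y s) ->
  forall s, 0 <= force B g y s.
Proof.
  intros Hg Hsol Hpos s0. apply Rnot_lt_le. intros HF0.
  pose proof (damping_pos _ _ _ Hg) as HA.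
  set (F := force B g y) in *.
  assert (HF : forall s, continuous F s)
    by (intros s; eapply force_continuous; eauto).
  assert (Hz : forall s, F s <= 0 -> z s <= 0).
  { intros s Hs. apply Rnot_lt_le. intros Hzs.
    pose proof (slope_le_force A B g y z Hg Hsol Hpos s Hzs). fold F in H. nra. }
  (* [F <= 0] keeps [y] above [y s0], where convexity carries the sign of
     [F s0] to earlier times *)
  assert (Hback : forall s, s <= s0 ->
            (forall x, s <= x <= s0 -> F x <= 0) ->
            y s0 <= y s /\ F s * y s0 <= F s0 * y s).
  { intros s Hs HFx.
    assert (Hy : y s0 <= y s).
    { apply (nonincreasing_of_derive y s s0 Hs). intros x Hx.
      exists (z x). split; [apply Hsol | apply Hz, HFx, Hx]. }
    split; [exact Hy |].
    pose proof (decreasing_in_time _ _ _ Hg (y s) s s0 (Hpos s) Hs).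
    pose proof (G0_star_shaped _ (y s0) (y s) (profile_G0 _ _ _ Hg s0)
                  (Hpos s0) Hy) as Hstar.
    simpl in Hstar. pose proof (Hpos s0).
    unfold F, force. nra. }
  assert (HFneg : forall s, s <= s0 -> F s < 0).
  { intros s1 Hs1. apply Rnot_le_lt. intros HF1.
    destruct (last_zero F s1 s0 HF Hs1 HF1 HF0) as [t [Ht [HFt Hlater]]].
    destruct (Hback t) as [Hy Hc]; [lra | |].
    { intros x [[Hx | <-] Hx']; [| lra]. left. apply Hlater. lra. }
    rewrite HFt in Hc. pose proof (Hpos t). nra. }
  assert (Hall : forall s, s <= s0 -> y s0 <= y s /\ F s * y s0 <= F s0 * y s).
  { intros s Hs. apply Hback; [exact Hs |]. intros x Hx. left. apply HFneg. lra. }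
  assert (HFc : forall s, s <= s0 -> F s <= F s0).
  { intros s Hs. destruct (Hall s Hs) as [Hy Hc]. pose proof (Hpos s0). nra. }
  (* [z + A y] has derivative [F], so that [y] is unbounded *)
  assert (Hgrow : forall s, s <= s0 ->
            z s0 + A * y s0 - F s0 * (s0 - s) <= A * y s).
  { intros s Hs.
    pose proof (backward_ge_of_slope_le (fun t => z t + A * y t) F s0 (- F s0))
      as Hu.
    assert (z s0 + A * y s0 + - F s0 * (s0 - s) <= z s + A * y s).
    { apply Hu; [| | exact Hs].
      - intros t. eapply is_derive_value.
        + apply (is_derive_plus z (fun t => A * y t)); [apply Hsol |].
          apply (is_derive_scal y t A (z t)), Hsol.
        + unfold plus; simpl. fold F. ring.
      - intros t Ht. specialize (HFc t Ht). lra. }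
    pose proof (Hz s (Rlt_le _ _ (HFneg s Hs))). lra. }
  destruct (G0_superlinear _ (B + A ^ 2 / 4 + 1) (profile_G0 _ _ _ Hg s0))
    as [Y [HY Hsup]].
  (* [s1] is early enough for [Hgrow] to give [Y <= y] before [s1] *)
  set (D := Rabs (A * Y - z s0 - A * y s0)).
  pose proof (Rle_abs (A * Y - z s0 - A * y s0)) as HD.
  pose proof (Rabs_pos (A * Y - z s0 - A * y s0)) as HD0. fold D in HD, HD0.
  set (s1 := s0 - D / - F s0).
  assert (Hs1 : - F s0 * (s0 - s1) = D) by (unfold s1; field; lra).
  assert (Hs10 : s1 <= s0) by nra.
  assert (Hylarge : forall s, s <= s1 -> Y <= y s).
  { intros s Hs. pose proof (Hgrow s ltac:(lra)).
    assert (- F s0 * (s0 - s1) <= - F s0 * (s0 - s))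
      by (apply Rmult_le_compat_l; lra).
    nra. }
  (* once [g y >= (B + A^2 / 4 + 1) y], the Riccati variable [x = z / y]
     satisfies [x' = F / y - A x - x^2 <= - 1 - (x + A / 2)^2], so it becomes
     positive at early times *)
  assert (Hric : forall s, s <= s1 ->
            z s1 / y s1 + 1 * (s1 - s) <= z s / y s).
  { intros s Hs.
    apply (backward_ge_of_slope_le (fun t => z t / y t)
             (fun t => (F t * y t - A * z t * y t - z t ^ 2) / y t ^ 2) s1 1);
      [| | exact Hs].
    - intros t. destruct (Hsol t) as [Hy' Hz']. pose proof (Hpos t).
      eapply is_derive_value.
      + apply is_derive_div; [exact Hz' | exact Hy' | lra].
      + fold F. field. lra.
    - intros t Ht. pose proof (Hpos t).
      pose proof (Hsup (y t) (Hylarge t Ht)) as Hg1. simpl in Hg1.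
      pose proof (decreasing_in_time _ _ _ Hg (y t) t s0 (Hpos t) ltac:(lra)).
      assert (F t <= - (A ^ 2 / 4 + 1) * y t) by (unfold F, force; lra).
      apply (Rmult_le_reg_r (y t ^ 2)); [nra |].
      unfold Rdiv. rewrite Rmult_assoc, Rinv_l by nra.
      assert (0 <= (z t + A / 2 * y t) ^ 2) by apply pow2_ge_0.
      nra. }
  set (x1 := z s1 / y s1).
  pose proof (Rabs_pos x1). pose proof (Rle_abs (- x1)) as Hx1.
  rewrite Rabs_Ropp in Hx1.
  pose proof (Hric (s1 - Rabs x1 - 1) ltac:(lra)) as Hlast. fold x1 in Hlast.
  set (s := s1 - Rabs x1 - 1) in *.
  assert (Hzs : z s <= 0) by (apply Hz; left; apply HFneg; unfold s; lra).
  assert (z s / y s <= 0).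
  { unfold Rdiv. pose proof (Rinv_0_lt_compat _ (Hpos s)). nra. }
  unfold s in Hlast at 1. lra.
Qed.

(** [exp (A s) z] is nondecreasing by [force_nonneg]. So a negative slope was at
    least as steep at all earlier times, and [y] would be unbounded there, which
    [g (y s) s <= B * y s] excludes for a superlinear [g]. *)
Lemma slope_nonneg (A B : R) (g : R -> R -> R) (y z : R -> R) :
  damped_nonlinearity A B g -> damped_solution A B g y z ->
  (forall s, 0 < y s) ->
  forall s, 0 <= z s.
Proof.
  intros Hg Hsol Hpos s0. apply Rnot_lt_le. intros Hz0.
  pose proof (damping_pos _ _ _ Hg) as HA.
  assert (Hz : forall s, s <= s0 -> z s <= - - z s0).
  { intros s Hs.
    assert (Hm : exp (A * s) * z s <= exp (A * s0) * z s0).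
    { apply (nondecreasing_of_derive (fun t => exp (A * t) * z t) s s0 Hs).
      intros x Hx. eexists. split; [apply is_derive_exp_mul, Hsol |].
      pose proof (force_nonneg A B g y z Hg Hsol Hpos x).
      apply Rmult_le_pos; [left; apply exp_pos | lra]. }
    assert (exp (A * s) <= exp (A * s0)).
    { destruct Hs as [Hs | ->]; [| lra]. left. apply exp_increasing. nra. }
    pose proof (exp_pos (A * s)). nra. }
  pose proof (backward_ge_of_slope_le y z s0 (- z s0)
                (fun s => proj1 (Hsol s)) Hz) as Hgrow.
  destruct (G0_superlinear _ (B + 1) (profile_G0 _ _ _ Hg s0)) as [Y [HY Hsup]].
  set (s := s0 - Y / - z s0).
  assert (Hs : - z s0 * (s0 - s) = Y) by (unfold s; field; lra).
  assert (Hs0 : s <= s0) by nra.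
  pose proof (Hgrow s Hs0) as Hys. rewrite Hs in Hys.
  pose proof (Hpos s0). pose proof (Hsup (y s) ltac:(lra)) as Hlarge.
  simpl in Hlarge.
  pose proof (decreasing_in_time _ _ _ Hg (y s) s s0 (Hpos s) Hs0).
  pose proof (force_nonneg A B g y z Hg Hsol Hpos s) as HF. unfold force in HF.
  pose proof (Hpos s). nra.
Qed.

(** Let [v = exp (A s / 2) (y1 - y2)]. Then
    [v'' = exp (A s / 2) ((B + A^2 / 4) (y1 - y2) - (g (y1) - g (y2)))], which is
    nonnegative as long as [y2 <= y1]: by convexity the chord of [g] is at most
    the tangent slope at [y1], which [force_nonneg] and the discriminant
    condition bound. A convex function that is bounded at minus infinity cannot
    decrease to a zero. *)
Lemma strict_comparison (A B : R) (g : R -> R -> R) (y1 z1 y2 z2 : R -> R) :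
  damped_nonlinearity A B g ->
  damped_solution A B g y1 z1 -> damped_solution A B g y2 z2 ->
  (forall s, 0 < y1 s) -> (forall s, 0 <= y2 s) ->
  (exists s0, forall s, s <= s0 -> y2 s < y1 s) ->
  forall s, y2 s < y1 s.
Proof.
  intros Hg Hsol1 Hsol2 Hpos1 Hpos2 [s0 Hs0] s1. apply Rnot_le_lt. intros Hs1.
  pose proof (damping_pos _ _ _ Hg) as HA.
  assert (Hs01 : s0 < s1).
  { apply Rnot_le_lt. intros H. pose proof (Hs0 s1 H). lra. }
  assert (Hwd : forall s, is_derive (fun s => y1 s - y2 s) s (z1 s - z2 s)).
  { intros s. exact (is_derive_minus y1 y2 s _ _ (proj1 (Hsol1 s)) (proj1 (Hsol2 s))). }
  (* first contact, as a last zero in reversed time *)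
  assert (exists t, s0 < t /\ y1 t - y2 t = 0 /\
            forall s, s < t -> 0 < y1 s - y2 s) as [t [Hst [Ht Hbefore]]].
  { destruct (last_zero (fun x => - (y1 (- x) - y2 (- x))) (- s1) (- s0))
      as [t [Ht [Hwt Hlater]]].
    - intros x.
      apply (continuous_opp (V := R_NormedModule)
               (fun x => y1 (- x) - y2 (- x))).
      apply (continuous_comp Ropp (fun s => y1 s - y2 s)).
      + apply (continuous_opp (V := R_NormedModule) (fun x => x)).
        apply continuous_id.
      + apply (ex_derive_continuous (V := R_NormedModule)).
        eexists; apply Hwd.
    - lra.
    - rewrite Ropp_involutive. lra.
    - rewrite Ropp_involutive. pose proof (Hs0 s0 ltac:(lra)). lra.
    - exists (- t). split; [lra | split; [lra |]].
      intros s Hs. destruct (Rle_or_lt s s0) as [Hle | Hgt].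
      + pose proof (Hs0 s Hle). lra.
      + pose proof (Hlater (- s) ltac:(lra)) as Hl.
        rewrite Ropp_involutive in Hl. lra. }
  set (v := fun s => exp (A / 2 * s) * (y1 s - y2 s)).
  set (v' := fun s => exp (A / 2 * s) * (z1 s - z2 s + A / 2 * (y1 s - y2 s))).
  assert (Hv : forall s, is_derive v s (v' s)).
  { intros s. unfold v, v'.
    exact (is_derive_exp_mul (fun s => y1 s - y2 s) _ s _ (Hwd s)). }
  assert (Hconvex : forall a b, a <= b -> b <= t -> v' a <= v' b).
  { intros a b Hab Hbt. apply (nondecreasing_of_derive v' a b Hab).
    intros x Hx. eexists. split.
    { unfold v'. apply is_derive_exp_mul.
      apply (is_derive_plus (fun s => z1 s - z2 s)
               (fun s => A / 2 * (y1 s - y2 s))).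
      - apply (is_derive_minus z1 z2); [apply Hsol1 | apply Hsol2].
      - apply is_derive_scal, Hwd. }
    apply Rmult_le_pos; [left; apply exp_pos |].
    unfold minus, plus, opp; simpl. unfold force.
    pose proof (force_nonneg A B g y1 z1 Hg Hsol1 Hpos1 x) as HF.
    unfold force in HF.
    pose proof (damping_dominates _ _ _ Hg (y1 x) x (Hpos1 x) ltac:(lra)) as Hdom.
    assert (Hle : 0 <= y1 x - y2 x).
    { destruct (Rle_lt_or_eq_dec x t) as [Hlt | ->]; [lra | | lra].
      left. apply Hbefore, Hlt. }
    pose proof (G0_tangent_above _ (y2 x) (y1 x) (profile_G0 _ _ _ Hg x)
                  (Hpos2 x) (Hpos1 x) ltac:(lra)) as Htan. simpl in Htan.
    assert (Derive (fun x0 => g x0 x) (y1 x) * (y1 x - y2 x)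
              <= (B + A ^ 2 / 4) * (y1 x - y2 x))
      by (apply Rmult_le_compat_r; lra).
    nra. }
  assert (exists c, c < t /\ v' c < 0) as [c [Hct Hvc]].
  { destruct (MVT_cor2 v v' (t - 1) t) as [c [Hc Hc']]; [lra | |].
    - intros c _. apply is_derive_Reals, Hv.
    - exists c. split; [lra |]. unfold v at 1 in Hc. rewrite Ht in Hc.
      assert (0 < v (t - 1)); [| nra].
      unfold v. apply Rmult_lt_0_compat; [apply exp_pos |]. apply Hbefore. lra. }
  pose proof (backward_ge_of_slope_le v v' c (- v' c) Hv) as Hgrow.
  assert (Hslopes : forall s, s <= c -> v' s <= - - v' c).
  { intros s Hs. pose proof (Hconvex s c Hs ltac:(lra)). lra. }
  specialize (Hgrow Hslopes).
  assert (Hbound : forall s, s <= c -> v s <= exp (A / 2 * c) * y1 c).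
  { intros s Hs. unfold v.
    assert (y1 s <= y1 c).
    { apply (nondecreasing_of_derive y1 s c Hs). intros x Hx. exists (z1 x).
      split; [apply Hsol1 |]. eapply slope_nonneg; eauto. }
    assert (exp (A / 2 * s) <= exp (A / 2 * c)).
    { destruct Hs as [Hs | ->]; [| lra]. left. apply exp_increasing. nra. }
    pose proof (Hpos2 s). pose proof (Hbefore s ltac:(lra)).
    pose proof (exp_pos (A / 2 * s)).
    apply Rmult_le_compat; lra. }
  set (M := exp (A / 2 * c) * y1 c) in *.
  assert (HM : 0 < M) by (apply Rmult_lt_0_compat; [apply exp_pos | apply Hpos1]).
  set (s := c - M / - v' c).
  assert (Hs : - v' c * (c - s) = M) by (unfold s; field; lra).
  assert (Hsc : s <= c) by nra.
  pose proof (Hgrow s Hsc). pose proof (Hbound s Hsc).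
  assert (0 < v c).
  { unfold v. apply Rmult_lt_0_compat; [apply exp_pos | apply Hbefore; lra]. }
  lra.
Qed.

(** * Power nonlinearities *)

(** The bound [y < 1] serves to compare powers of [y] with [y] itself. *)
Lemma Rpower_small (b e eps delta : R) :
  0 < e -> 0 < eps -> 0 < delta ->
  exists y, 0 < y < delta /\ y < 1 /\ Rabs b * Rpower y e <= eps.
Proof.
  intros He Heps Hdelta.
  pose proof (Rabs_pos b) as Hb.
  set (t := eps / (Rabs b + 1)).
  assert (Ht : 0 < t) by (apply Rdiv_lt_0_compat; lra).
  set (y := Rmin (Rmin (delta / 2) (1 / 2)) (Rpower t (/ e))).
  assert (Hy : 0 < y).
  { unfold y. repeat apply Rmin_glb_lt; try lra. apply exp_pos. }
  assert (y <= delta / 2 /\ y <= 1 / 2 /\ y <= Rpower t (/ e)) as (H1 & H2 & H3).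
  { unfold y. pose proof (Rmin_l (Rmin (delta / 2) (1 / 2)) (Rpower t (/ e))).
    pose proof (Rmin_r (Rmin (delta / 2) (1 / 2)) (Rpower t (/ e))).
    pose proof (Rmin_l (delta / 2) (1 / 2)).
    pose proof (Rmin_r (delta / 2) (1 / 2)). lra. }
  exists y. split; [lra | split; [lra |]].
  assert (Rpower y e <= t).
  { replace t with (Rpower (Rpower t (/ e)) e).
    - apply Rle_Rpower_l; lra.
    - rewrite Rpower_mult, Rinv_l by lra. apply Rpower_1, Ht. }
  assert (Heq : t * (Rabs b + 1) = eps) by (unfold t; field; lra).
  pose proof (exp_pos (e * ln y)) as Hp. fold (Rpower y e) in Hp.
  nra.
Qed.

Lemma Rpower_base_1 (p : R) : Rpower 1 p = 1.
Proof. unfold Rpower. now rewrite ln_1, Rmult_0_r, exp_0. Qed.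

Lemma Rpower_split (y p q : R) : Rpower y q = Rpower y p * Rpower y (q - p).
Proof. rewrite <- Rpower_plus. f_equal. ring. Qed.

Lemma G0_low_coefficient_nonneg (h : R -> R) (a b p1 p2 : R) :
  G0 h -> p1 < p2 ->
  (forall y, 0 < y -> h y = a * Rpower y p1 + b * Rpower y p2) ->
  0 <= a.
Proof.
  intros HG Hp Hh. apply Rnot_lt_le. intros Ha.
  destruct (Rpower_small b (p2 - p1) (- a / 2) 1) as [y [Hy [_ Hb]]]; try lra.
  pose proof (G0_nonneg h y HG ltac:(lra)) as H0.
  rewrite (Hh y), (Rpower_split y p1 p2) in H0 by lra.
  pose proof (exp_pos (p1 * ln y)) as Hp1. fold (Rpower y p1) in Hp1.
  pose proof (exp_pos ((p2 - p1) * ln y)) as Hpd.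
  fold (Rpower y (p2 - p1)) in Hpd.
  pose proof (Rle_abs b).
  assert (b * Rpower y (p2 - p1) <= - a / 2) by nra.
  nra.
Qed.

(** Otherwise [a * y^p1] would dominate at [0], against [h y = o(y)]. *)
Lemma G0_sublinear_coefficient_zero (h : R -> R) (a b p1 p2 : R) :
  G0 h -> p1 < p2 -> p1 <= 1 ->
  (forall y, 0 < y -> h y = a * Rpower y p1 + b * Rpower y p2) ->
  a = 0.
Proof.
  intros HG Hp Hp1 Hh.
  pose proof (G0_low_coefficient_nonneg h a b p1 p2 HG Hp Hh) as Ha.
  destruct Ha as [Ha | ]; [exfalso | auto].
  destruct (G0_small h (a / 4) HG) as [d [Hd Hsmall]]; [lra |].
  destruct (Rpower_small b (p2 - p1) (a / 2) d) as [y [Hy [Hy1 Hb]]]; try lra.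
  pose proof (Hsmall y Hy) as H0. apply Rabs_le_between in H0.
  rewrite (Hh y), (Rpower_split y p1 p2) in H0 by lra.
  assert (Hyp : y <= Rpower y p1).
  { rewrite (Rpower_split y 1 p1), Rpower_1 by lra.
    assert (1 <= Rpower y (p1 - 1)); [| nra].
    unfold Rpower. rewrite <- exp_0 at 1.
    assert (ln y < 0) by (rewrite <- ln_1; apply ln_increasing; lra).
    assert (Hnn : 0 <= (p1 - 1) * ln y) by nra.
    destruct Hnn as [Hnn | <-]; [left; apply exp_increasing, Hnn | lra]. }
  pose proof (exp_pos ((p2 - p1) * ln y)) as Hpd.
  fold (Rpower y (p2 - p1)) in Hpd.
  pose proof (Rle_abs (- b)) as Hab. rewrite Rabs_Ropp in Hab.
  assert (- (a / 2) <= b * Rpower y (p2 - p1)) by nra.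
  nra.
Qed.

Lemma G0_top_exponent (h : R -> R) (a b p1 p2 : R) :
  G0 h -> p1 < p2 ->
  (forall y, 0 < y -> h y = a * Rpower y p1 + b * Rpower y p2) ->
  1 < p2.
Proof.
  intros HG Hp Hh. apply Rnot_le_lt. intros Hp2.
  assert (Ha : a = 0) by (apply (G0_sublinear_coefficient_zero h a b p1 p2); auto; lra).
  subst a.
  assert (Hb : b = 0).
  { apply (G0_sublinear_coefficient_zero h b 0 p2 (p2 + 1)); auto; [lra |].
    intros y Hy. rewrite (Hh y Hy). ring. }
  subst b.
  destruct (G0_superlinear h 1 HG) as [Y [HY Hs]].
  specialize (Hs Y ltac:(lra)). rewrite (Hh Y HY) in Hs. lra.
Qed.

Definition two_power_form (g : R -> R -> R) (a b : R -> R) (p1 p2 : R) : Prop :=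
  forall y s, 0 < y -> g y s = a s * Rpower y p1 + b s * Rpower y p2.

(** How one power term of [f] transforms under the change of variables. *)
Lemma gfun_power (k d p m y s : R) :
  0 < y ->
  k * Rpower (exp s) d * Rpower (y * exp (- m * s)) p * exp ((m + 2) * s)
  = k * exp ((d + 2 - m * (p - 1)) * s) * Rpower y p.
Proof.
  intros Hy. rewrite <- Rpower_mult_distr by (try apply exp_pos; assumption).
  unfold Rpower at 1 3. rewrite !ln_exp.
  replace ((d + 2 - m * (p - 1)) * s)
    with (d * s + p * (- m * s) + (m + 2) * s) by ring.
  rewrite !exp_plus. ring.
Qed.

(** The lower power disappears at infinity. In the two-term case, write
    [m2 = (2 + d2) / (q2 - 2)]: the coefficient of the upper power is at least
    [c * exp ((q2 - 2) (m2 - m) s)] for large [s], and it is bounded because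
    [g] converges and [a >= 0], so [m2 <= m]. The exponent [d1 + 2 - m (q1 - 2)] of the lower
    coefficient is then at most its value at [m2], which is the negative number
    in (K). The one-term case fits the same form with [a = 0] and an arbitrary
    smaller exponent [p1]. *)
Lemma K_two_power_form (n : nat) (f : R -> R -> R) (ls : R) :
  G2 n f ls -> K f ->
  exists a b p1 p2,
    p1 < p2 /\ 1 < p2 /\ (forall s, 0 <= a s) /\
    (forall eps, 0 < eps -> Rbar_locally p_infty (fun s => a s <= eps)) /\
    two_power_form (gfun f ls) a b p1 p2.
Proof.
  intros [[ginf [_ [_ [Hcvg _]]]] [HG0 _]] [HK | HK].
  - destruct HK as (k & d & q & _ & Hf).
    set (b := fun s => k (exp s) * exp ((d + 2 - mexp ls * (q - 1 - 1)) * s)).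
    assert (Hform : two_power_form (gfun f ls) (fun _ => 0) b (q - 2) (q - 1)).
    { intros y s Hy. unfold gfun.
      assert (Hu : 0 < y * exp (- mexp ls * s))
        by (apply Rmult_lt_0_compat; [exact Hy | apply exp_pos]).
      rewrite Hf by (try apply exp_pos; exact Hu).
      rewrite gfun_power by exact Hy. unfold b. ring. }
    exists (fun _ => 0), b, (q - 2), (q - 1).
    split; [lra | split].
    { apply (G0_top_exponent _ 0 (b 0) (q - 2) (q - 1) (HG0 0)); [lra |].
      intros y Hy. apply Hform, Hy. }
    split; [intros; lra | split; [| exact Hform]].
    intros eps Heps. exists 0. intros; lra.
  - destruct HK as (k1 & k2 & d1 & d2 & q1 & q2 & Hq & _ & _ & Hexp & Hf & c & C & Hc & HcC).
    set (m := mexp ls).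
    set (a := fun s => k1 (exp s) * exp ((d1 + 2 - m * (q1 - 1 - 1)) * s)).
    set (b := fun s => k2 (exp s) * exp ((d2 + 2 - m * (q2 - 1 - 1)) * s)).
    assert (Hform : two_power_form (gfun f ls) a b (q1 - 1) (q2 - 1)).
    { intros y s Hy. unfold gfun.
      assert (Hu : 0 < y * exp (- mexp ls * s))
        by (apply Rmult_lt_0_compat; [exact Hy | apply exp_pos]).
      rewrite Hf by (try apply exp_pos; exact Hu).
      rewrite Rabs_pos_eq by lra.
      rewrite Rmult_plus_distr_r, !gfun_power by exact Hy. reflexivity. }
    assert (Ha : forall s, 0 <= a s).
    { intros s. apply (G0_low_coefficient_nonneg _ (a s) (b s) (q1 - 1) (q2 - 1) (HG0 s)); [lra |].
      intros y Hy. apply Hform, Hy. }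
    assert (Hq2 : 1 < q2 - 1).
    { apply (G0_top_exponent _ (a 0) (b 0) (q1 - 1) (q2 - 1) (HG0 0)); [lra |].
      intros y Hy. apply Hform, Hy. }
    exists a, b, (q1 - 1), (q2 - 1).
    split; [lra | split; [exact Hq2 | split; [exact Ha | split; [| exact Hform]]]].
    intros eps Heps.
    destruct (Rle_or_lt q1 2) as [Hq1 | Hq1].
    { exists 0. intros s _.
      rewrite (G0_sublinear_coefficient_zero _ (a s) (b s) (q1 - 1) (q2 - 1) (HG0 s)); try lra.
      intros y Hy. apply Hform, Hy. }
    destruct HcC as [R0 HR0].
    assert (Hk : forall s, Rabs R0 < s -> k1 (exp s) <= C /\ c <= k2 (exp s)).
    { intros s Hs. apply HR0. pose proof (Rle_abs R0). pose proof (Rabs_pos R0).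
      pose proof (exp_ineq1 s ltac:(lra)). lra. }
    assert (Hlin : forall x, 1 + x <= exp x) by (intros x; apply exp_ineq1_le).
    (* boundedness of [b] forces [(2 + d2) / (q2 - 2) <= m] *)
    assert (Hm : d2 + 2 - m * (q2 - 1 - 1) <= 0).
    { apply Rnot_lt_le. intros Hpos.
      set (e := d2 + 2 - m * (q2 - 1 - 1)) in *.
      destruct (Hcvg 1 1 ltac:(lra) ltac:(lra) 1 ltac:(lra)) as [S HS].
      set (M := Rabs (ginf 1) + 1).
      pose proof (Rabs_pos (ginf 1)).
      assert (Hce : 0 < c * e) by nra.
      set (s := Rabs R0 + Rabs S + M / (c * e) + 1).
      assert (HMe : 0 < M / (c * e)) by (apply Rdiv_lt_0_compat; unfold M; lra).
      pose proof (Rabs_pos R0). pose proof (Rabs_pos S). pose proof (Rle_abs S).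
      destruct (Hk s ltac:(unfold s; lra)) as [_ Hk2].
      pose proof (HS s ltac:(unfold s; lra) 1 ltac:(lra)) as Hg.
      rewrite (Hform 1 s) in Hg by lra.
      rewrite !Rpower_base_1, !Rmult_1_r in Hg.
      apply Rabs_def2 in Hg. pose proof (Rle_abs (ginf 1)).
      assert (Hbs : b s <= M) by (pose proof (Ha s); unfold M; lra).
      assert (c * (1 + e * s) <= b s).
      { unfold b. fold e. pose proof (Hlin (e * s)).
        assert (0 < e * s) by (apply Rmult_lt_0_compat; [assumption | unfold s; lra]).
        apply Rmult_le_compat; lra. }
      assert (c * e * (M / (c * e)) = M) by (field; lra).
      assert (c * e * (M / (c * e)) < c * e * s)
        by (apply Rmult_lt_compat_l; [lra | unfold s; lra]).
      lra. }
    assert (Hneg : d1 + 2 - m * (q1 - 1 - 1) < 0).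
    { assert (Hx : (2 + d2) / (q2 - 2) <= m).
      { apply (Rmult_le_reg_r (q2 - 2)); [lra |].
        unfold Rdiv. rewrite Rmult_assoc, Rinv_l by lra. lra. }
      assert (Hy : (2 + d2) / (q2 - 2) * (q2 - 2) = 2 + d2) by (field; lra).
      set (x := (2 + d2) / (q2 - 2)) in *.
      nra. }
    set (e := - (d1 + 2 - m * (q1 - 1 - 1))).
    assert (He : 0 < e) by (unfold e; lra).
    pose proof (Rabs_pos C) as HC.
    exists (Rabs R0 + (Rabs C / (e * eps))). intros s Hs.
    pose proof (Rabs_pos R0).
    assert (Hee : 0 < e * eps) by nra.
    assert (HCe : 0 <= Rabs C / (e * eps)) by (apply Rdiv_le_0_compat; lra).
    destruct (Hk s) as [Hk1 _]; [lra |].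
    assert (HCs : Rabs C <= e * eps * s).
    { replace (Rabs C) with (e * eps * (Rabs C / (e * eps))) by (field; lra).
      apply Rmult_le_compat_l; lra. }
    unfold a.
    replace ((d1 + 2 - m * (q1 - 1 - 1)) * s) with (- (e * s)) by (unfold e; ring).
    rewrite exp_Ropp.
    pose proof (Hlin (e * s)). pose proof (exp_pos (e * s)) as Hep.
    apply (Rmult_le_reg_r (exp (e * s))); [exact Hep |].
    rewrite Rmult_assoc, Rinv_l by lra.
    pose proof (Rle_abs C). nra.
Qed.

Lemma Rpower_derive (y p : R) :
  0 < y -> is_derive (fun x => Rpower x p) y (p * Rpower y (p - 1)).
Proof. intros Hy. apply is_derive_Reals, derivable_pt_lim_power, Hy. Qed.

Lemma Rpower_succ (y p : R) : 0 < y -> Rpower y (p - 1) * y = Rpower y p.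
Proof.
  intros Hy. rewrite <- (Rpower_1 y Hy) at 2. rewrite <- Rpower_plus.
  f_equal. ring.
Qed.

Lemma locally_pos (y : R) : 0 < y -> locally y (fun x => 0 < x).
Proof. apply (open_gt 0 y). Qed.

Lemma limit_profile_is_power (g : R -> R -> R) (a b : R -> R) (p1 p2 : R) (ginf : R -> R) :
  two_power_form g a b p1 p2 -> (forall s, 0 <= a s) ->
  (forall eps, 0 < eps -> Rbar_locally p_infty (fun s => a s <= eps)) ->
  cvg_compact_pos g p_infty ginf ->
  forall y, 0 < y -> ginf y = ginf 1 * Rpower y p2.
Proof.
  intros Hform Ha Ha0 Hcvg y Hy.
  pose proof (exp_pos (p1 * ln y)) as Hp1. fold (Rpower y p1) in Hp1.
  pose proof (exp_pos (p2 * ln y)) as Hp2. fold (Rpower y p2) in Hp2.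
  set (w := Rpower y p1 + 2 * Rpower y p2 + 1).
  assert (Hw : 0 < w) by (unfold w; lra).
  assert (Habs : Rabs (ginf y - ginf 1 * Rpower y p2) <= 0);
    [| apply Rabs_le_between in Habs; lra].
  apply le_epsilon. intros e He. rewrite Rplus_0_l.
  set (eps := e / w). assert (Heps : 0 < eps) by (apply Rdiv_lt_0_compat; lra).
  assert (Hew : e = eps * w) by (unfold eps; field; lra).
  destruct (Ha0 eps Heps) as [S1 H1].
  destruct (Hcvg y y Hy ltac:(lra) eps Heps) as [S2 H2].
  destruct (Hcvg 1 1 ltac:(lra) ltac:(lra) eps Heps) as [S3 H3].
  set (s := Rmax S1 (Rmax S2 S3) + 1).
  assert (S1 < s /\ S2 < s /\ S3 < s) as (Hs1 & Hs2 & Hs3).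
  { unfold s. pose proof (Rmax_l S1 (Rmax S2 S3)).
    pose proof (Rmax_r S1 (Rmax S2 S3)).
    pose proof (Rmax_l S2 S3). pose proof (Rmax_r S2 S3). lra. }
  specialize (H1 s Hs1). specialize (H2 s Hs2 y ltac:(lra)).
  specialize (H3 s Hs3 1 ltac:(lra)).
  rewrite (Hform y s Hy) in H2. rewrite (Hform 1 s) in H3 by lra.
  rewrite !Rpower_base_1, !Rmult_1_r in H3.
  apply Rabs_def2 in H2. apply Rabs_def2 in H3. pose proof (Ha s).
  assert (0 <= a s * Rpower y p1 <= eps * Rpower y p1) by
    (split; [apply Rmult_le_pos; lra | apply Rmult_le_compat_r; lra]).
  assert ((b s - ginf 1) * Rpower y p2 <= eps * Rpower y p2)
    by (apply Rmult_le_compat_r; lra).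
  assert (- (2 * eps) * Rpower y p2 <= (b s - ginf 1) * Rpower y p2)
    by (apply Rmult_le_compat_r; lra).
  assert (0 < eps * Rpower y p2) by nra.
  assert (0 < eps * Rpower y p1) by nra.
  rewrite Hew. unfold w. apply Rabs_le. lra.
Qed.

(** For a power, [h' P = p * h P / P = p * B], so the point [P] drops out. *)
Lemma sigma_equation_power (n : nat) (h : R -> R) (beta p l : R) :
  (forall y, 0 < y -> h y = beta * Rpower y p) ->
  sigma_equation n h l -> 4 * p * Bcoef n l = (INR n - 2) ^ 2.
Proof.
  intros Hh (_ & HB & P & [[HP HgP] _] & Heq).
  assert (HD : Derive h P = p * Bcoef n l).
  { rewrite (Derive_ext_loc h (fun y => beta * Rpower y p)).
    2:{ generalize (locally_pos P HP). apply filter_imp. exact Hh. }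
    etransitivity.
    { apply is_derive_unique, is_derive_scal, Rpower_derive, HP. }
    apply (Rmult_eq_reg_r P); [| lra].
    rewrite (Hh P HP), <- (Rpower_succ P p HP) in HgP.
    transitivity (p * (beta * (Rpower P (p - 1) * P))); [ring |].
    rewrite HgP. ring. }
  rewrite HD in Heq. unfold Acoef, Bcoef in *. nra.
Qed.

(** [sigma_low] and [sigma] have the same [B], so their exponents [m] are
    symmetric about [(n - 2) / 2] and the smaller one belongs to [sigma]. On the
    left of the point of symmetry [B] increases with [m], and [m] decreases
    with [l]; so [B] at [ls] is at most [B] at [sigma], which is
    [(n - 2)^2 / (4 p)], and [A^2 + 4 B = (n - 2)^2] at every [l]. *)
Lemma threshold_power (n : nat) (h : R -> R) (beta p sigma ls : R) :
  (2 < n)%nat -> (forall y, 0 < y -> h y = beta * Rpower y p) ->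
  1 < p -> is_sigma_upper n h sigma -> sigma <= ls ->
  0 < Acoef n ls /\ p * Bcoef n ls <= Bcoef n ls + Acoef n ls ^ 2 / 4.
Proof.
  intros Hn Hh Hp [low [Hlow Hroots]] Hls.
  assert (H1 : sigma_equation n h low) by (apply Hroots; auto).
  assert (H2 : sigma_equation n h sigma) by (apply Hroots; auto).
  pose proof (sigma_equation_power n h beta p low Hh H1) as E1.
  pose proof (sigma_equation_power n h beta p sigma Hh H2) as E2.
  destruct H1 as [L1 _]. destruct H2 as [L2 _].
  assert (Hdec : forall l l', 2 < l -> l < l' -> mexp l' < mexp l).
  { intros l l' Hl Hll. unfold mexp, Rdiv. apply Rmult_lt_compat_l; [lra |].
    apply Rinv_lt_contravar; [nra | lra]. }
  pose proof (Hdec low sigma L1 Hlow) as Hm.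
  assert (Hmls : mexp ls <= mexp sigma).
  { destruct Hls as [Hls | ->]; [| lra]. left. apply Hdec; lra. }
  assert (Hbb : Bcoef n low = Bcoef n sigma).
  { apply (Rmult_eq_reg_l (4 * p)); lra. }
  unfold Bcoef, Acoef in *.
  assert (Hsum : mexp low + mexp sigma = INR n - 2).
  { apply (Rmult_eq_reg_l (mexp low - mexp sigma)); lra. }
  split; [lra |].
  assert (mexp ls * (INR n - 2 - mexp ls) <= mexp sigma * (INR n - 2 - mexp sigma)).
  { assert (0 <= (mexp sigma - mexp ls) * (INR n - 2 - mexp sigma - mexp ls)); [| lra].
    apply Rmult_le_pos; lra. }
  assert (p * (mexp ls * (INR n - 2 - mexp ls))
            <= p * (mexp sigma * (INR n - 2 - mexp sigma)))
    by (apply Rmult_le_compat_l; lra).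
  lra.
Qed.

(** As [a s >= 0] and [p1 < p2], the elasticity [y g_y / g] is at most [p2]; so
    [g <= B y] gives [g_y <= p2 B]. *)
Lemma two_power_damped (A B : R) (g : R -> R -> R) (a b : R -> R) (p1 p2 : R) :
  0 < A -> p1 < p2 -> two_power_form g a b p1 p2 -> (forall s, 0 <= a s) ->
  0 < p2 -> p2 * B <= B + A ^ 2 / 4 ->
  (forall s, G0 (fun x => g x s)) ->
  (forall y s1 s2, 0 < y -> s1 <= s2 -> g y s2 <= g y s1) ->
  (forall y s, 0 < y -> ex_derive (g y) s) ->
  damped_nonlinearity A B g.
Proof.
  intros HA Hp Hform Ha Hp2 HpB HG Hdec Hex.
  assert (Hgy : forall y s, 0 < y -> is_derive (fun x : R => g x s) y
            (a s * (p1 * Rpower y (p1 - 1)) + b s * (p2 * Rpower y (p2 - 1)))).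
  { intros y s Hy.
    apply (is_derive_ext_loc (fun x => a s * Rpower x p1 + b s * Rpower x p2)).
    { generalize (locally_pos y Hy). apply filter_imp.
      intros x Hx. symmetry. apply Hform, Hx. }
    apply (is_derive_plus (fun x => a s * Rpower x p1) (fun x => b s * Rpower x p2));
      apply is_derive_scal, Rpower_derive, Hy. }
  (* the coefficients are combinations of [g 1] and [g 2] *)
  set (c1 := Rpower 2 p1). set (c2 := Rpower 2 p2).
  assert (Hc : c1 < c2) by (apply Rpower_lt; lra).
  assert (Hbd : forall s, ex_derive b s).
  { intros s.
    apply (ex_derive_ext (fun t => / (c2 - c1) * (g 2 t - c1 * g 1 t))).
    { intros t. rewrite (Hform 1 t), (Hform 2 t) by lra.
      rewrite !Rpower_base_1. fold c1 c2. simpl. field. lra. }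
    apply ex_derive_scal.
    apply (ex_derive_minus (g 2) (fun t => c1 * g 1 t)); [apply Hex; lra |].
    apply ex_derive_scal, Hex. lra. }
  assert (Had : forall s, ex_derive a s).
  { intros s. apply (ex_derive_ext (fun t => g 1 t - b t)).
    { intros t. rewrite (Hform 1 t) by lra. rewrite !Rpower_base_1.
      simpl. ring. }
    apply (ex_derive_minus (g 1) b); [apply Hex; lra | apply Hbd]. }
  constructor; auto.
  - intros y s y' Hy Hy'.
    pose proof (Derive_correct _ _ (Had s)) as Hda.
    pose proof (Derive_correct _ _ (Hbd s)) as Hdb.
    exists (Derive a s * Rpower (y s) p1 + Derive b s * Rpower (y s) p2).
    split.
    + apply (derive_nonpos_of_nonincreasing (g (y s)) s).
      { intros s1 s2. apply Hdec, Hy. }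
      apply (is_derive_ext (fun t => a t * Rpower (y s) p1 + b t * Rpower (y s) p2)).
      { intros t. symmetry. apply Hform, Hy. }
      apply (is_derive_plus (fun t => a t * Rpower (y s) p1)
               (fun t => b t * Rpower (y s) p2)).
      * apply (is_derive_scal_l a s (Derive a s) (Rpower (y s) p1) Hda).
      * apply (is_derive_scal_l b s (Derive b s) (Rpower (y s) p2) Hdb).
    + rewrite (is_derive_unique _ _ _ (Hgy (y s) s Hy)).
      apply (is_derive_ext_loc
               (fun t => a t * Rpower (y t) p1 + b t * Rpower (y t) p2)).
      { assert (Hc' : continuous y s)
          by (apply (ex_derive_continuous (V := R_NormedModule)); eexists; exact Hy').
        pose proof (Hc' _ (locally_pos (y s) Hy)) as Hloc.
        unfold filtermap in Hloc. revert Hloc. apply filter_imp.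
        intros t Ht. symmetry. apply Hform, Ht. }
      assert (Hcomp : forall p, is_derive (fun t => Rpower (y t) p) s
                (y' * (p * Rpower (y s) (p - 1)))).
      { intros p. apply (is_derive_comp (fun x => Rpower x p) y).
        - apply Rpower_derive, Hy.
        - exact Hy'. }
      eapply is_derive_value.
      * apply (is_derive_plus (fun t => a t * Rpower (y t) p1)
                 (fun t => b t * Rpower (y t) p2)).
        -- apply (is_derive_mult a (fun t => Rpower (y t) p1));
             [exact Hda | apply Hcomp | exact Rmult_comm].
        -- apply (is_derive_mult b (fun t => Rpower (y t) p2));
             [exact Hdb | apply Hcomp | exact Rmult_comm].
      * unfold plus, mult; simpl. ring.
  - intros y s Hy Hle.
    rewrite (is_derive_unique _ _ _ (Hgy y s Hy)).
    apply (Rmult_le_reg_r y); [exact Hy |].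
    rewrite (Hform y s Hy) in Hle.
    pose proof (Rpower_succ y p1 Hy) as S1. pose proof (Rpower_succ y p2 Hy) as S2.
    replace ((a s * (p1 * Rpower y (p1 - 1)) + b s * (p2 * Rpower y (p2 - 1))) * y)
      with (p1 * (a s * Rpower y p1) + p2 * (b s * Rpower y p2))
      by (rewrite <- S1, <- S2; ring).
    pose proof (exp_pos (p1 * ln y)) as Hpos. fold (Rpower y p1) in Hpos.
    assert (0 <= a s * Rpower y p1) by (apply Rmult_le_pos; [apply Ha | lra]).
    assert (p1 * (a s * Rpower y p1) <= p2 * (a s * Rpower y p1))
      by (apply Rmult_le_compat_r; lra).
    assert (p2 * (a s * Rpower y p1 + b s * Rpower y p2) <= p2 * (B * y))
      by (apply Rmult_le_compat_l; lra).
    assert (p2 * B * y <= (B + A ^ 2 / 4) * y) by (apply Rmult_le_compat_r; lra).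
    lra.
Qed.

Lemma gfun_damped (n : nat) (f : R -> R -> R) (ls : R) :
  (2 < n)%nat -> G3 n f ls -> K f ->
  damped_nonlinearity (Acoef n ls) (Bcoef n ls) (gfun f ls).
Proof.
  intros Hn [HG2 Hdec] HK.
  destruct (K_two_power_form n f ls HG2 HK)
    as (a & b & p1 & p2 & Hp & Hp2 & Ha & Ha0 & Hform).
  destruct HG2 as [[ginf (_ & _ & Hcvg & sigma & Hsigma & Hls)] [HG [Hex _]]].
  pose proof (limit_profile_is_power _ a b p1 p2 ginf Hform Ha Ha0 Hcvg) as Hpow.
  destruct (threshold_power n ginf (ginf 1) p2 sigma ls Hn Hpow Hp2 Hsigma Hls)
    as [HA HpB].
  apply (two_power_damped _ _ _ a b p1 p2); auto; [lra |].
  intros y s1 s2 Hy Hs. apply Hdec; assumption.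
Qed.

(** * The Fowler transformation *)

Definition fowler (m : R) (U : R -> R) (s : R) : R := U (exp s) * exp (m * s).

Definition fowler_slope (m : R) (U : R -> R) (s : R) : R :=
  m * fowler m U s + Derive U (exp s) * exp ((m + 1) * s).

Lemma fowler_solution (n : nat) (f : R -> R -> R) (l : R) (U : R -> R) :
  is_solution n f U ->
  damped_solution (Acoef n l) (Bcoef n l) (gfun f l)
    (fowler (mexp l) U) (fowler_slope (mexp l) U).
Proof.
  intros HU s. set (m := mexp l).
  destruct (HU (exp s) (exp_pos s)) as (_ & HU1 & HU2 & Heq).
  assert (Hy : is_derive (fowler m U) s (fowler_slope m U s)).
  { unfold fowler, fowler_slope. auto_derive; [exact HU1 |].
    change (fun x => U x) with U. unfold fowler.
    replace ((m + 1) * s) with (m * s + s) by ring. rewrite exp_plus. ring. }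
  split; [exact Hy |].
  assert (Hexp : is_derive (fun t => exp ((m + 1) * t)) s
            ((m + 1) * exp ((m + 1) * s))) by (auto_derive; [exact I | ring]).
  unfold fowler_slope at 1.
  eapply is_derive_value.
  - apply (is_derive_plus (fun s => m * fowler m U s)
             (fun s => Derive U (exp s) * exp ((m + 1) * s))).
    + apply is_derive_scal, Hy.
    + apply (is_derive_mult (fun s => Derive U (exp s)) (fun s => exp ((m + 1) * s)));
        [| | exact Rmult_comm].
      * apply (is_derive_comp (Derive U) exp).
        -- apply Derive_correct, HU2.
        -- apply is_derive_exp.
      * exact Hexp.
  - unfold plus, mult, scal; simpl. unfold mult; simpl.
    unfold force, gfun. fold m.
    replace (fowler m U s * exp (- m * s)) with (U (exp s)).
    2:{ unfold fowler. rewrite Rmult_assoc, <- exp_plus.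
        replace (m * s + - m * s) with 0 by ring. rewrite exp_0. ring. }
    assert (Hf : f (U (exp s)) (exp s)
              = - Derive (Derive U) (exp s)
                - (INR n - 1) / exp s * Derive U (exp s)) by lra.
    rewrite Hf. unfold fowler_slope, Acoef, Bcoef. fold m.
    replace ((m + 2) * s) with (m * s + s + s) by ring.
    replace ((m + 1) * s) with (m * s + s) by ring.
    rewrite !exp_plus. pose proof (exp_pos s). field. lra.
Qed.

Lemma fowler_ln (m : R) (U : R -> R) (r : R) :
  0 < r -> fowler m U (ln r) = U r * Rpower r m.
Proof. intros Hr. unfold fowler, Rpower. now rewrite exp_ln. Qed.

Lemma regular_below_singular_near_0 (n : nat) (f : R -> R -> R) (alpha : R) (U Uinf : R -> R) :
  is_regular_solution n f alpha U -> is_singular_solution n f Uinf ->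
  exists d, 0 < d /\ forall r, 0 < r < d -> U r < Uinf r.
Proof.
  intros (_ & _ & HU) (_ & _ & Hinf).
  assert (H1 : at_right 0 (fun r => U r < alpha + 1)).
  { apply (HU (fun u => u < alpha + 1)). apply (open_lt (alpha + 1) alpha). lra. }
  assert (H2 : at_right 0 (fun r => alpha + 1 < Uinf r)).
  { apply (Hinf (fun u => alpha + 1 < u)). exists (alpha + 1). auto. }
  destruct (filter_and _ _ H1 H2) as [d Hd].
  exists d. split; [apply cond_pos |]. intros r [Hr Hrd].
  destruct (Hd r) as [Ha Hb]; [| exact Hr | lra].
  unfold ball; simpl; unfold AbsRing_ball, abs, minus, plus, opp; simpl.
  apply Rabs_def1; lra.
Qed.

Theorem proposition2p13 :
  forall (n : nat) (f : R -> R -> R) (lu ls : R) (Uinf : R -> R),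
    (2 < n)%nat ->
    (forall r, 0 < r -> f 0 r = 0) ->
    G1 n f lu -> G2 n f ls -> G3 n f ls -> K f ->
    is_singular_solution n f Uinf ->
    (forall r1 r2, 0 < r1 -> r1 <= r2 ->
       Uinf r1 * Rpower r1 (mexp ls) <= Uinf r2 * Rpower r2 (mexp ls)) /\
    (forall (alpha : R) (U : R -> R),
       0 < alpha -> is_regular_solution n f alpha U ->
       forall r, 0 < r -> U r < Uinf r).
Proof.
  intros n f lu ls Uinf Hn _ _ _ HG3 HK Hsing.
  pose proof (gfun_damped n f ls Hn HG3 HK) as Hg.
  assert (Hsol := fowler_solution n f ls Uinf (proj1 Hsing)).
  assert (Hpos : forall s, 0 < fowler (mexp ls) Uinf s).
  { intros s. apply Rmult_lt_0_compat; [apply Hsing |]; apply exp_pos. }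
  split.
  - intros r1 r2 Hr1 Hr. rewrite <- !fowler_ln by lra.
    apply nondecreasing_of_derive.
    { destruct Hr as [Hr | ->]; [left; apply ln_increasing; lra | lra]. }
    intros s _. exists (fowler_slope (mexp ls) Uinf s). split; [apply Hsol |].
    eapply slope_nonneg; eauto.
  - intros alpha U _ HU r Hr.
    destruct (regular_below_singular_near_0 n f alpha U Uinf HU Hsing)
      as [d [Hd Hnear]].
    assert (Hlt : fowler (mexp ls) U (ln r) < fowler (mexp ls) Uinf (ln r)).
    { apply (strict_comparison _ _ _ _ _ _ _ Hg Hsol
               (fowler_solution n f ls U (proj1 HU))); [exact Hpos | |].
      - intros s. apply Rmult_le_pos; [apply (proj1 HU) | left]; apply exp_pos.
      - exists (ln d - 1). intros s Hs. apply Rmult_lt_compat_r; [apply exp_pos |].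
        apply Hnear. split; [apply exp_pos |].
        rewrite <- (exp_ln d Hd). apply exp_increasing. lra. }
    rewrite !fowler_ln in Hlt by exact Hr.
    apply (Rmult_lt_reg_r (Rpower r (mexp ls))); [apply exp_pos | exact Hlt].
Qed.
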